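(* Let $\mathbf u^\lambda$ denote, for $\lambda>0$, the unique continuous viscosity solution of the discounted system $(B+\lambda\,\mathrm{Id})\mathbf u+\mathbb H(x,D\mathbf u)=c(\mathbb H)\mathbbm 1$ in $M$. Then, as $\lambda\to0^+$, the functions $\mathbf u^\lambda$ converge uniformly on $M$ to a single function $\mathbf u^0:M\to\mathbb R^m$, which is a viscosity solution of the critical system $B\mathbf u+\mathbb H(x,D\mathbf u)=c(\mathbb H)\mathbbm 1$ in $M$.
   Context: Let $M=\mathbb T^N$ be the flat $N$-dimensional torus, with $TM=T^*M=M\times\mathbb R^N$. Let $m\ge1$ and let $H_1,\dots,H_m:T^*M\to\mathbb R$ be continuous functions such that: (H1) $p\mapsto H_i(x,p)$ is convex for every $x\in M$; (H2) there exist coercive functions $\alpha,\beta:[0,\infty)\to\mathbb R$ (i.e. tending to $+\infty$ at $+\infty$) with $\alpha(|p|)\le H_i(x,p)\le\beta(|p|)$ for all $(x,p)$ and all $i$. Let $B=(b_{ij})$ be a real $m\times m$ matrix with $b_{ij}\le0$ for $j\ne i$ and $\sum_{j=1}^m b_{ij}=0$ for every $i$, which is irreducible: for every nonempty proper subset $\mathcal I\subsetneq\{1,\dots,m\}$ there exist $i\in\mathcal I$, $j\notin\mathcal I$ with $b_{ij}\neq0$. Write $\mathbbm 1=(1,\dots,1)^T$ and $\mathbb H(x,D\mathbf u)=(H_1(x,Du_1),\dots,H_m(x,Du_m))^T$. For $\lambda\ge0$, $c\in\mathbb R$, the system $(B+\lambda\mathrm{Id})\mathbf u+\mathbb H(x,D\mathbf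 u)=c\mathbbm 1$ means $\sum_j b_{ij}u_j+\lambda u_i+H_i(x,Du_i)=c$ for $i=1,\dots,m$, for continuous $\mathbf u=(u_1,\dots,u_m)^T:M\to\mathbb R^m$, understood in the viscosity sense: $\mathbf u$ is a subsolution if $H_i(x,p)+((B+\lambda\mathrm{Id})\mathbf u(x))_i\le c$ for all $x$, $i$, $p\in D^+u_i(x)$; a supersolution if the reverse inequality holds for all $p\in D^-u_i(x)$; a solution if both. The critical value $c(\mathbb H)$ is the unique $c\in\mathbb R$ for which the system with $\lambda=0$ admits a viscosity solution (equivalently, the minimal $c$ for which it admits a subsolution). For $\lambda>0$ and any $c$ the system has a unique continuous viscosity solution. *)

(* Defs.v *)
From HB Require Import structures.
From mathcomp Require Import all_boot all_order all_algebra.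
From mathcomp Require Import reals.
Set Implicit Arguments. Unset Strict Implicit. Unset Printing Implicit Defensive.
Import Order.TTheory GRing.Theory Num.Theory.
Local Open Scope ring_scope.

Section Defs.
Variables (R : realType) (N m : nat).

(* points of R^N (universal cover of the flat torus T^N) and covectors *)
Definition vec := 'I_N -> R.
Definition vadd (x y : vec) : vec := fun k => x k + y k.
Definition vsub (x y : vec) : vec := fun k => x k - y k.
Definition vscale (t : R) (x : vec) : vec := fun k => t * x k.
Definition vdot (p y : vec) : R := \sum_(k < N) p k * y k.
Definition vnorm (x : vec) : R := Num.sqrt (\sum_(k < N) x k ^+ 2).
Definition vint (z : 'I_N -> int) : vec := fun k => (z k)%:~R.

(* f : R^N -> R is Z^N-periodic, i.e. a function on M = T^N *)
Definition periodic (f : vec -> R) : Prop :=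
  forall x (z : 'I_N -> int), f (vadd x (vint z)) = f x.

Definition vcontinuous (f : vec -> R) : Prop :=
  forall x (e : R), 0 < e -> exists2 d : R, 0 < d &
    forall y, vnorm (vsub y x) < d -> `|f y - f x| < e.

Definition superdiff (f : vec -> R) (x p : vec) : Prop :=
  forall e : R, 0 < e -> exists2 d : R, 0 < d &
    forall y, vnorm (vsub y x) < d ->
      f y - f x - vdot p (vsub y x) <= e * vnorm (vsub y x).

Definition subdiff (f : vec -> R) (x p : vec) : Prop :=
  forall e : R, 0 < e -> exists2 d : R, 0 < d &
    forall y, vnorm (vsub y x) < d ->
      f y - f x - vdot p (vsub y x) >= - (e * vnorm (vsub y x)).

(* Hamiltonians H_i : T*M -> R, H i x p *)
Definition Ham := 'I_m -> vec -> vec -> R.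

Definition coercive (a : R -> R) : Prop :=
  forall K : R, exists r : R, forall s, r <= s -> K <= a s.

Definition ham_hyp (H : Ham) : Prop :=
  (forall i x p (e : R), 0 < e -> exists2 d : R, 0 < d &
     forall y q, vnorm (vsub y x) < d -> vnorm (vsub q p) < d ->
       `|H i y q - H i x p| < e) /\
  (forall i x p (z : 'I_N -> int), H i (vadd x (vint z)) p = H i x p) /\
  (forall i x p q (t : R), 0 <= t <= 1 ->
     H i x (vadd (vscale t p) (vscale (1 - t) q))
       <= t * H i x p + (1 - t) * H i x q) /\
  (exists alpha beta : R -> R, coercive alpha /\ coercive beta /\
     forall i x p, alpha (vnorm p) <= H i x p <= beta (vnorm p)).

Definition coupling (B : 'M[R]_m) : Prop :=
  (forall i j : 'I_m, i != j -> B i j <= 0) /\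
  (forall i : 'I_m, \sum_(j < m) B i j = 0) /\
  (forall I : {set 'I_m}, I != set0 -> I != setT ->
     exists i j, [/\ i \in I, j \notin I & B i j != 0]).

Definition sys := 'I_m -> vec -> R.

Definition sys_on_M (u : sys) : Prop :=
  forall i, vcontinuous (u i) /\ periodic (u i).

Definition coup (B : 'M[R]_m) (lam : R) (u : sys) (i : 'I_m) (x : vec) : R :=
  \sum_(j < m) B i j * u j x + lam * u i x.

Definition visc_sub (B : 'M[R]_m) (H : Ham) (lam c : R) (u : sys) : Prop :=
  sys_on_M u /\
  forall i x p, superdiff (u i) x p -> H i x p + coup B lam u i x <= c.

Definition visc_super (B : 'M[R]_m) (H : Ham) (lam c : R) (u : sys) : Prop :=
  sys_on_M u /\
  forall i x p, subdiff (u i) x p -> H i x p + coup B lam u i x >= c.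

Definition visc_sol (B : 'M[R]_m) (H : Ham) (lam c : R) (u : sys) : Prop :=
  visc_sub B H lam c u /\ visc_super B H lam c u.

Definition is_critical_value (B : 'M[R]_m) (H : Ham) (c : R) : Prop :=
  exists u : sys, visc_sol B H 0 c u.

End Defs.

(* Main.v *)
Require Import Defs.
From HB Require Import structures.
From mathcomp Require Import all_boot all_order all_algebra.
From mathcomp Require Import reals.
From mathcomp Require Import all_classical topology normedtype derive.
From mathcomp Require Import ring lra.
Set Implicit Arguments.
Unset Strict Implicit. Unset Printing Implicit Defensive.
Import Order.TTheory GRing.Theory Num.Theory.
Import numFieldNormedType.Exports.
Local Open Scope ring_scope.

(* Write u^nu for the solution with discount nu.  Let nu < lam < mu and write
   lam = (1-t) nu + t mu.  By convexity, phi = (1-t) u^nu + t u^mu satisfies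
     (B + lam) phi + H(x, D phi) <= c + s (u^nu - u^mu),
     s = (1-t) (lam - nu) = t (mu - lam) <= lam,
   so comparison gives u^lam >= phi - max (u^nu - u^mu)^+.  The family (u^lam) is
   bounded (compare with a critical solution) and equi-Lipschitz (coercivity),
   hence totally bounded: for every e, all small discounts fall in finitely many
   classes of diameter e, each of which recurs at arbitrarily small discounts.
   Taking nu in the class of mu shows u^lam >= u^mu - O(e) for all lam < mu, and
   comparing u^mu with another member of its class lying below lam gives the
   reverse inequality.  So (u^lam) is uniformly Cauchy as lam -> 0, and viscosity
   solutions are stable under uniform limits.

   The comparison for phi is made without showing that a convex combination of
   viscosity subsolutions is one: the variables of u^nu, u^mu and u^lam are
   tripled, with a penalty for which the gradients p, q, r of the three functions
   at a maximum satisfy r = (1-t) p + t q exactly. *)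

(** * Euclidean geometry of vectors and one-sided differentials *)

Section Vectors.
Context {R : realType} {N : nat}.
Local Notation V := (vec R N).
Implicit Types x y p : V.

Lemma vdotC x y : vdot x y = vdot y x.
Proof. by apply: eq_bigr => k _; rewrite mulrC. Qed.

Lemma vdotDl p x y : vdot (vadd x y) p = vdot x p + vdot y p.
Proof. by rewrite -big_split; apply: eq_bigr => k _; rewrite mulrDl. Qed.

Lemma vdotBl p x y : vdot (vsub x y) p = vdot x p - vdot y p.
Proof. by rewrite -sumrB; apply: eq_bigr => k _; rewrite mulrBl. Qed.

Lemma vdotZl t x y : vdot (vscale t x) y = t * vdot x y.
Proof. by rewrite mulr_sumr; apply: eq_bigr => k _; rewrite mulrA. Qed.

Lemma vdotDr p x y : vdot p (vadd x y) = vdot p x + vdot p y.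
Proof. by rewrite vdotC vdotDl 2!(vdotC p). Qed.

Lemma vdotBr p x y : vdot p (vsub x y) = vdot p x - vdot p y.
Proof. by rewrite vdotC vdotBl 2!(vdotC p). Qed.

Lemma vdotZr t x y : vdot x (vscale t y) = t * vdot x y.
Proof. by rewrite vdotC vdotZl vdotC. Qed.

Definition vdotE := (vdotDl, vdotDr, vdotBl, vdotBr, vdotZl, vdotZr).

Lemma vnorm_ge0 x : 0 <= vnorm x.
Proof. exact: sqrtr_ge0. Qed.

Lemma vdot_ge0 x : 0 <= vdot x x.
Proof. by apply: sumr_ge0 => k _; rewrite -expr2 sqr_ge0. Qed.

Lemma vnorm_sqr x : vnorm x ^+ 2 = vdot x x.
Proof. by rewrite sqr_sqrtr ?sumr_ge0// => k _; rewrite sqr_ge0. Qed.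

Lemma vnorm_coord x k : `|x k| <= vnorm x.
Proof.
rewrite -sqrtr_sqr ler_wsqrtr// (bigD1 k)//= lerDl sumr_ge0// => j _.
exact: sqr_ge0.
Qed.

Lemma vnorm_eq0 x k : vnorm x = 0 -> x k = 0.
Proof.
by move=> x0; have := vnorm_coord x k; rewrite x0 normr_le0 => /eqP.
Qed.

(** Cauchy-Schwarz: expand the square of [|y| x - |x| y] and divide by [|x| |y|], which is why null
    vectors are treated first. *)
Lemma vdot_le_vnorm x y : vdot x y <= vnorm x * vnorm y.
Proof.
have := vnorm_ge0 x; rewrite le_eqVlt => /orP[/eqP x0|x0].
  by rewrite -x0 mul0r /vdot big1// => k _; rewrite vnorm_eq0 ?mul0r.
have := vnorm_ge0 y; rewrite le_eqVlt => /orP[/eqP y0|y0].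
  by rewrite -y0 mulr0 /vdot big1// => k _; rewrite (vnorm_eq0 (x := y)) ?mulr0.
have := vdot_ge0 (vsub (vscale (vnorm y) x) (vscale (vnorm x) y)).
rewrite !vdotE -!vnorm_sqr (vdotC y x) => h.
have xy : 0 < vnorm x * vnorm y by rewrite mulr_gt0.
rewrite -(ler_pM2l xy); nra.
Qed.

Lemma vnormD x y : vnorm (vadd x y) <= vnorm x + vnorm y.
Proof.
rewrite -(@ler_pXn2r _ 2) ?nnegrE ?vnorm_ge0 ?addr_ge0 ?vnorm_ge0//.
rewrite vnorm_sqr !vdotE (vdotC y x) -!vnorm_sqr.
have := vdot_le_vnorm x y; lra.
Qed.

Lemma vnormZ t x : vnorm (vscale t x) = `|t| * vnorm x.
Proof.
rewrite -sqrtr_sqr -sqrtrM ?sqr_ge0// mulr_sumr.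
by congr Num.sqrt; apply: eq_bigr => k _; rewrite exprMn.
Qed.

Lemma vnormBC x y : vnorm (vsub x y) = vnorm (vsub y x).
Proof.
by congr Num.sqrt; apply: eq_bigr => k _; rewrite /vsub -sqrrN opprB.
Qed.

Lemma vnorm_le_coord x (r : R) :
  0 <= r -> (forall k, `|x k| <= r) -> vnorm x <= N%:R * r.
Proof.
move=> r0 xr.
rewrite -(@ler_pXn2r _ 2) ?nnegrE ?vnorm_ge0 ?mulr_ge0 ?ler0n//.
rewrite vnorm_sqr exprMn -natrX (@le_trans _ _ (N%:R * r ^+ 2))//.
  rewrite mulr_natl -[X in _ *+ X]card_ord -sumr_const ler_sum// => k _.
  by rewrite -expr2 -real_normK ?num_real// lerXn2r ?nnegrE.
rewrite ler_wpM2r ?sqr_ge0// ler_nat -mulnn.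
by case: (N) => // n; rewrite leq_pmulr.
Qed.

Lemma vnorm_sub_tri x y z :
  vnorm (vsub x z) <= vnorm (vsub x y) + vnorm (vsub y z).
Proof.
have -> : vsub x z = vadd (vsub x y) (vsub y z).
  by apply/funext => k; rewrite /vadd /vsub addrA subrK.
exact: vnormD.
Qed.

Lemma vnorm_sqrD x y :
  vnorm (vadd x y) ^+ 2 = vnorm x ^+ 2 + 2 * vdot x y + vnorm y ^+ 2.
Proof. by rewrite !vnorm_sqr !vdotE (vdotC y x); ring. Qed.

Lemma vnorm_sqrB x y :
  vnorm (vsub x y) ^+ 2 = vnorm x ^+ 2 - 2 * vdot x y + vnorm y ^+ 2.
Proof. by rewrite !vnorm_sqr !vdotE (vdotC y x); ring. Qed.

Lemma vadd_sub x y : vadd x (vsub y x) = y.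
Proof. by apply/funext => k; rewrite /vadd /vsub addrC subrK. Qed.

Lemma vsub_add x y : vsub (vadd x y) x = y.
Proof. by apply/funext => k; rewrite /vadd /vsub addrC addKr. Qed.

(* A quadratic remainder is absorbed by the [e * |y - x|] slack. *)
Lemma superdiff_quad (f : V -> R) x p A r : 0 < r ->
  (forall y, vnorm (vsub y x) < r ->
     f y - f x <= vdot p (vsub y x) + A * vnorm (vsub y x) ^+ 2) ->
  superdiff f x p.
Proof.
move=> r0 h e e0; exists (Num.min r (e / (`|A| + 1))).
  by rewrite lt_min r0 divr_gt0// ltr_wpDl.
move=> y; rewrite lt_min => /andP[yr ye].
have := h _ yr; rewrite ltr_pdivlMr ?ltr_wpDl// in ye.
have := vnorm_ge0 (vsub y x); set d := vnorm _ in ye *.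
have := ler_norm A; have := normr_ge0 A; nra.
Qed.

Lemma superdiffN (f : V -> R) x p :
  superdiff (fun y => - f y) x (vscale (-1) p) <-> subdiff f x p.
Proof.
by split=> h e /h[d d0 {}h]; exists d => // y /h; rewrite vdotZl; lra.
Qed.

End Vectors.

(* Resolution does not see through the filtered structure on matrices. *)
#[local] Instance rV_nbhs_filter (R : realType) N (v : 'rV[R]_N)
  : Filter (nbhs v).
Proof. exact: nbhs_filter. Qed.

(** * Compactness, periodicity and existence of penalized maxima *)

Section Compactness.
Context {R : realType}.

(** Row vectors carry the sup-norm topology, and the Euclidean norm is at most [N] times the sup
    norm. Dividing by [N.+1] gives a strict bound and covers [N = 0]. *)
Lemma near_vnorm N (v : 'rV[R]_N) (d : R) : 0 < d ->
  \forall w \near v, vnorm (vsub ((w : 'rV[R]_N) ord0) (v ord0) : vec R N) < d.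
Proof.
move=> d0; have e0 : 0 < d / N.+1%:R by rewrite divr_gt0.
have := nbhsx_ballx v _ e0; apply: filterS => w [_ vw].
have h : vnorm (vsub (w ord0) (v ord0) : vec R N) <= N%:R * (d / N.+1%:R).
  apply: (vnorm_le_coord (ltW e0)) => k.
  by have := vw ord0 k; rewrite /ball /= => /ltW; rewrite distrC.
apply: (le_lt_trans h).
rewrite mulrCA -ltr_pdivlMl// mulVf ?gt_eqF// ltr_pdivrMr ?ltr0Sn//.
by rewrite mul1r ltr_nat.
Qed.

Lemma vcontinuous_rV N (f : vec R N -> R) :
  vcontinuous f -> continuous (fun v : 'rV[R]_N => f (v ord0)).
Proof.
move=> cf v; apply/cvgrPdist_lt => e /(cf (v ord0))[d d0 h].
by apply: filterS (near_vnorm v d0) => w /h; rewrite distrC.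
Qed.

Lemma vcontinuous_translate N (f : vec R N -> R) x : vcontinuous f ->
  continuous (fun v : 'rV[R]_N => f (vadd x (v ord0))).
Proof.
move=> cf; apply: (vcontinuous_rV (f := fun a => f (vadd x a))) => a e e0.
have [d d0 hd] := cf (vadd x a) e e0; exists d => // b ba; apply: hd.
rewrite (_ : vsub _ _ = vsub b a)//.
by apply/funext => k; rewrite /vsub /vadd; ring.
Qed.

Lemma vnorm_continuous N :
  continuous (fun v : 'rV[R]_N => vnorm (v ord0 : vec R N)).
Proof.
move=> v; apply/cvgrPdist_lt => e /(near_vnorm v).
apply: filterS => w h.
have h1 := vnormD (v ord0) (vsub (w ord0) (v ord0)).
have h2 := vnormD (w ord0) (vsub (v ord0) (w ord0)).
rewrite !vadd_sub vnormBC in h1 h2.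
rewrite vnormBC in h.
by rewrite ltr_norml; lra.
Qed.

Lemma vdot_continuous N (p : vec R N) :
  continuous (fun v : 'rV[R]_N => vdot p (v ord0)).
Proof.
apply: vcontinuous_rV => x e e0.
have p1 : 0 < vnorm p + 1 by rewrite ltr_wpDl ?vnorm_ge0.
exists (e / (vnorm p + 1)); first by rewrite divr_gt0.
move=> y; rewrite ltr_pdivlMr// -vdotBr => ye.
have h1 := vdot_le_vnorm p (vsub y x).
have h2 := vdot_le_vnorm (vscale (-1) p) (vsub y x).
rewrite vdotZl vnormZ normrN1 mul1r in h2.
by have := vnorm_ge0 (vsub y x); rewrite ltr_norml; nra.
Qed.

(** Cubes are taken in row vectors, where a product of segments is known to be compact; [row_vecK]
    goes back to functions. *)
Definition box N (lo hi : R) : set 'rV[R]_N :=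
  [set v | forall k, lo <= v ord0 k <= hi]%classic.
Arguments box : clear implicits.

Lemma box_compact N lo hi : compact (box N lo hi).
Proof.
have := @rV_compact R N (fun=> [set x | lo <= x <= hi]%classic).
apply=> _; have := @segment_compact R lo hi.
by congr compact; apply/seteqP; split=> x /=; rewrite in_itv.
Qed.


Arguments box_compact : clear implicits.

Lemma unit_cube N (x : vec R N) : exists z : 'I_N -> int,
  forall k, 0 <= vadd x (vint R z) k <= 1.
Proof.
exists (fun k => - Num.floor (x k)) => k; rewrite /vadd /vint.
have := floor_itv (x k); rewrite rmorphD/= rmorphN/=.
lra.
Qed.

Lemma row_vecK N (x : vec R N) : (\row_k x k) ord0 = x.
Proof. by apply/funext => k; rewrite mxE. Qed.

Lemma periodic_bounded N (f : vec R N -> R) :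
  vcontinuous f -> periodic f -> exists2 C : R, 0 <= C & forall x, `|f x| <= C.
Proof.
move=> cf pf.
have B0 : (box N 0 1 !=set0)%classic.
  by exists 0 => k; rewrite mxE lexx ler01.
have {}cf := continuous_subspaceT (vcontinuous_rV cf) (A := box N 0 1).
have [c _ hc] := compact_EVT_max B0 (box_compact N 0 1) cf.
have [d _ hd] := compact_EVT_min B0 (box_compact N 0 1) cf.
exists (`|f (c ord0)| + `|f (d ord0)|); first by rewrite addr_ge0.
move=> x; have [z zx] := unit_cube x.
rewrite -(pf x z) -(row_vecK (vadd x (vint R z))).
have zB : (\row_k (vadd x (vint R z)) k : 'rV[R]_N) \in (box N 0 1).
  by rewrite inE => k; rewrite mxE zx.
have := hc _ zB; have := hd _ zB.
have := ler_norm (f (c ord0)); have := ler_norm (- f (d ord0)).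
rewrite normrN ler_norml.
have := normr_ge0 (f (c ord0)); have := normr_ge0 (f (d ord0)); lra.
Qed.

Lemma vadd_rV N (v w : 'rV[R]_N) : (v + w) ord0 = vadd (v ord0) (w ord0).
Proof. by apply/funext => k; rewrite mxE. Qed.

Lemma vcontinuous_add (T : topologicalType) N (f : vec R N -> R)
    (u v : T -> 'rV[R]_N) :
  vcontinuous f -> continuous u -> continuous v ->
  continuous (fun w => f (vadd (u w ord0) (v w ord0))).
Proof.
move=> cf cu cv w.
have -> : (fun w => f (vadd (u w ord0) (v w ord0))) =
          (fun w => f ((u w + v w) ord0)).
  by apply/funext => w'; rewrite vadd_rV.
apply: (@continuous_comp _ _ _ (fun w => u w + v w)
          (fun v : 'rV[R]_N => f (v ord0))).
  by apply: cvgD; [exact: cu|exact: cv].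
exact: vcontinuous_rV.
Qed.

Lemma periodic_shift N (f : vec R N -> R) (z : 'I_N -> int) x a :
  periodic f -> f (vadd (vadd x (vint R z)) a) = f (vadd x a).
Proof.
move=> pf; rewrite -[RHS](pf _ z); congr f; apply/funext => k.
by rewrite /vadd addrAC.
Qed.

Lemma not_box_vnorm N (a : vec R N) r :
  ~ box N (- r) r (\row_k a k) -> r < vnorm a.
Proof.
move=> /existsNP[k]; rewrite mxE -ler_norml => /negP; rewrite -ltNge => h.
exact: lt_le_trans (vnorm_coord a k).
Qed.

Lemma box0 N r : 0 <= r -> box N (- r) r (\row_k ((fun=> 0) : vec R N) k).
Proof. by move=> r0 k; rewrite mxE oppr_le0 r0. Qed.

Lemma vnorm0 N : vnorm ((fun=> 0) : vec R N) = 0.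
Proof. by rewrite /vnorm big1 ?sqrtr0// => k _; rewrite expr0n. Qed.

Lemma vadd0 N (x : vec R N) : vadd x (fun=> 0) = x.
Proof. by apply/funext => k; rewrite /vadd addr0. Qed.

(** Beyond radius [2 * C / K] the cone exceeds the oscillation of [f], so a maximum over a cube is
    global. It serves to turn a gradient bound into a Lipschitz bound. *)
Lemma cone_max N (f : vec R N -> R) x (K : R) : vcontinuous f -> periodic f ->
  0 < K -> exists a, forall b,
    f (vadd x b) - K * vnorm b <= f (vadd x a) - K * vnorm a.
Proof.
move=> cf pf K0; have [C C0 fC] := periodic_bounded cf pf.
pose r := 2 * C / K.
have r0 : 0 <= r by rewrite divr_ge0 ?mulr_ge0// ltW.
pose Phi (v : 'rV[R]_N) := f (vadd x (v ord0)) - K * vnorm (v ord0 : vec R N).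
have cPhi : continuous Phi.
  move=> v; apply: cvgB; last by apply: cvgMl_tmp; exact: vnorm_continuous.
  exact: vcontinuous_translate cf v.
have B0 : (box N (- r) r !=set0)%classic.
  by exists (\row_k ((fun=> 0) : vec R N) k); exact: box0.
have [c _ hc] := compact_EVT_max B0 (box_compact N (- r) r)
  (continuous_subspaceT cPhi (A := box N (- r) r)).
exists (c ord0) => b.
have [bB|/not_box_vnorm bB] := pselect (box N (- r) r (\row_k b k)).
  by have := hc _ (mem_set bB); rewrite /Phi row_vecK.
have := hc _ (mem_set (@box0 N r r0)); rewrite /Phi row_vecK vadd0 vnorm0.
have := fC x; have := fC (vadd x b); rewrite !ler_norml.
have : 2 * C < K * vnorm b by rewrite -ltr_pdivrMl// mulrC.
lra.
Qed.

(** The three points are written [z], [z + a], [z + b]: periodicity brings [z] into the unit cube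
    without changing the offsets, and the quadratic penalty confines [a] and [b]. *)
Lemma doubling_max N (f g h : vec R N -> R) (t A : R) :
  vcontinuous f -> periodic f -> vcontinuous g -> periodic g ->
  vcontinuous h -> periodic h -> 0 < t < 1 -> 0 < A ->
  exists z a b, forall z' a' b',
  (1 - t) * (f (vadd z' a') - A * vnorm a' ^+ 2) +
    t * (g (vadd z' b') - A * vnorm b' ^+ 2) - h z' <=
  (1 - t) * (f (vadd z a) - A * vnorm a ^+ 2) +
    t * (g (vadd z b) - A * vnorm b ^+ 2) - h z.
Proof.
move=> cf pf cg pg ch ph /andP[t0 t1] A0.
have [Cf Cf0 fC] := periodic_bounded cf pf.
have [Cg Cg0 gC] := periodic_bounded cg pg.
have [Ch Ch0 hC] := periodic_bounded ch ph.
pose C := 2 * (Cf + Cg + Ch).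
(* Either penalty alone reaches [C], twice the sum of the bounds on the three functions, at radius
   [r]; the summand [1] gives [r <= r ^+ 2]. *)
pose r := C / (A * (1 - t)) + C / (A * t) + 1.
have r1 : 1 <= r by rewrite lerDr addr_ge0// divr_ge0// /C; nra.
have r0 : 0 <= r by rewrite (le_trans ler01).
have rt1 : C <= A * (1 - t) * r ^+ 2.
  have : C <= A * (1 - t) * r.
    rewrite -ler_pdivrMl ?mulr_gt0 ?subr_gt0// mulrC /r -addrA lerDl.
    by rewrite addr_ge0// divr_ge0// /C; nra.
  by move/le_trans; apply; rewrite ler_wpM2l ?expr2 ?ler_peMl ?mulr_ge0//; lra.
have rt2 : C <= A * t * r ^+ 2.
  have : C <= A * t * r.
    rewrite -ler_pdivrMl ?mulr_gt0// mulrC /r addrAC lerDr.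
    by rewrite addr_ge0// divr_ge0// /C; nra.
  by move/le_trans; apply; rewrite ler_wpM2l ?expr2 ?ler_peMl ?mulr_ge0//; lra.
pose T3 := ('rV[R]_N * 'rV[R]_N * 'rV[R]_N)%type.
pose Phi (w : T3) :=
  (1 - t) * (f (vadd (w.1.1 ord0) (w.1.2 ord0)) -
             A * vnorm (w.1.2 ord0 : vec R N) ^+ 2) +
  t * (g (vadd (w.1.1 ord0) (w.2 ord0)) -
       A * vnorm (w.2 ord0 : vec R N) ^+ 2) - h (w.1.1 ord0).
have c11 : continuous (fun w : T3 => w.1.1).
  by move=> w; apply: continuous_comp; exact: cvg_fst.
have c12 : continuous (fun w : T3 => w.1.2).
  by move=> w; apply: continuous_comp; [exact: cvg_fst|exact: cvg_snd].
have c2 : continuous (fun w : T3 => w.2) by move=> w; exact: cvg_snd.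
have cn (u : T3 -> 'rV[R]_N) : continuous u ->
    continuous (fun w => A * vnorm (u w ord0 : vec R N) ^+ 2).
  move=> cu w; apply: cvgMl_tmp.
  have cw : continuous (fun w => vnorm (u w ord0 : vec R N)).
    move=> w'; apply: (@continuous_comp _ _ _ u
      (fun v : 'rV[R]_N => vnorm (v ord0 : vec R N))); first exact: cu.
    exact: vnorm_continuous.
  exact: (cvgM (cw w) (cw w)).
have cPhi : continuous Phi.
  move=> w; apply: cvgB; last first.
    apply: (@continuous_comp _ _ _ (fun w : T3 => w.1.1)
      (fun v : 'rV[R]_N => h (v ord0))); first exact: c11.
    exact: vcontinuous_rV.
  apply: cvgD; apply: cvgMl_tmp; apply: cvgB.
  - exact: vcontinuous_add cf c11 c12 w.
  - exact: cn c12 w.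
  - exact: vcontinuous_add cg c11 c2 w.
  - exact: cn c2 w.
pose K := ((box N 0 1 `*` box N (- r) r) `*` box N (- r) r)%classic.
have K0 : (K !=set0)%classic.
  exists ((0, \row_k ((fun=> 0) : vec R N) k), \row_k ((fun=> 0) : vec R N) k).
  split; [split|]; [|exact: box0|exact: box0].
  by move=> k; rewrite mxE lexx ler01.
have cK : compact K.
  by apply: compact_setX; [apply: compact_setX|]; exact: box_compact.
have [c _ hc] := compact_EVT_max K0 cK (continuous_subspaceT cPhi (A := K)).
exists (c.1.1 ord0), (c.1.2 ord0), (c.2 ord0) => z' a' b'.
have in_box a b : box N (- r) r (\row_k a k) -> box N (- r) r (\row_k b k) ->
   (1 - t) * (f (vadd z' a) - A * vnorm a ^+ 2) +
   t * (g (vadd z' b) - A * vnorm b ^+ 2) - h z' <= Phi c.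
  have [k kz] := unit_cube z'.
  move=> aB bB; have zB : box N 0 1 (\row_j vadd z' (vint R k) j).
    by move=> j; rewrite mxE kz.
  have := hc ((_, _), _) (mem_set (conj (conj zB aB) bB)).
  by rewrite /Phi/= !row_vecK !periodic_shift// ph.
(* An offset outside the cube does no better than zero offsets at the same [z]. *)
have [aB|/not_box_vnorm aB] :=
  pselect (box N (- r) r (\row_k a' k)); last first.
  have ib := in_box _ _ (@box0 N r r0) (@box0 N r r0).
  apply: (le_trans _ ib); rewrite !vadd0 !vnorm0 expr0n/=.
  have : A * (1 - t) * r ^+ 2 <= A * (1 - t) * vnorm a' ^+ 2.
    rewrite ler_wpM2l ?lerXn2r ?nnegrE ?vnorm_ge0 ?(ltW aB)//.
    by rewrite mulr_ge0 ?ltW// subr_gt0.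
  have : 0 <= A * t * vnorm b' ^+ 2.
    by rewrite !mulr_ge0 ?exprn_ge0 ?vnorm_ge0// ltW.
  have := fC z'; have := gC z'; have := hC z'.
  have := fC (vadd z' a'); have := gC (vadd z' b').
  rewrite !ler_norml /C in rt1 rt2 *; nra.
have [bB|/not_box_vnorm bB] :=
  pselect (box N (- r) r (\row_k b' k)); last first.
  have ib := in_box _ _ (@box0 N r r0) (@box0 N r r0).
  apply: (le_trans _ ib); rewrite !vadd0 !vnorm0 expr0n/=.
  have : A * t * r ^+ 2 <= A * t * vnorm b' ^+ 2.
    rewrite ler_wpM2l ?lerXn2r ?nnegrE ?vnorm_ge0 ?(ltW bB)//.
    by rewrite mulr_ge0 ?ltW.
  have : 0 <= A * (1 - t) * vnorm a' ^+ 2.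
    by rewrite !mulr_ge0 ?exprn_ge0 ?vnorm_ge0 ?subr_ge0// ltW.
  have := fC z'; have := gC z'; have := hC z'.
  have := fC (vadd z' a'); have := gC (vadd z' b').
  rewrite !ler_norml /C in rt1 rt2 *; nra.
exact: in_box.
Qed.

End Compactness.

(** * A priori estimates and comparison for convex combinations *)

Section Subsolutions.
Context {R : realType} {N m : nat}.
Local Notation V := (vec R N).
Implicit Types (x y z p q : V) (B : 'M[R]_m) (H : Ham R N m) (u v : sys R N m).

Lemma fin_lower_bound (T : finType) (D : T -> R) :
  (forall i, 0 < D i) -> exists2 d : R, 0 < d & forall i, d <= D i.
Proof.
(* The default value [1] keeps the minimum positive even when [T] is empty. *)
move=> D0; exists (\big[Num.min/1]_i D i); last by move=> i; exact: bigmin_le.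
by apply: (big_ind (fun d => 0 < d)) => // a b a0 b0; rewrite lt_min a0.
Qed.

(** Heine-Cantor on the unit cube times a cube of momenta, extended to all positions by periodicity.
    Compactness is used in its near-covering form, with the modulus [d] as the parameter tending to
    [0]. *)
Lemma ham_uniform H (K e : R) : ham_hyp H -> 0 < e ->
  exists2 d : R, 0 < d & forall i x z p, vnorm p <= K ->
    vnorm (vsub x z) < d -> `|H i x p - H i z p| < e.
Proof.
move=> [cH [pH _]] e0.
suff /choice[D hD] : forall i, exists d : R, 0 < d /\ forall x z p,
    vnorm p <= K -> vnorm (vsub x z) < d -> `|H i x p - H i z p| < e.
  have [i|d d0 dD] := @fin_lower_bound _ D; first by have [] := hD i.
  exists d => // i x z p pK xz; have [_] := hD i; apply => //.
  exact: lt_le_trans (dD i).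
move=> i.
have cB := compact_setX (@box_compact R N 0 1) (@box_compact R N (- K) K).
move/compact_near_coveringP : cB.
pose Q (d : R) (zp : 'rV[R]_N * 'rV[R]_N) := forall x,
  vnorm (vsub x (zp.1 ord0)) < d ->
  `|H i x (zp.2 ord0) - H i (zp.1 ord0) (zp.2 ord0)| < e.
move=> /(_ _ (nbhs (0 : R)) Q _) near_cover.
have [[z0 p0] _|d /= d0 hd] := near_cover.
  have e20 : 0 < e / 2 by rewrite divr_gt0.
  have [d d0 hd] := cH i (z0 ord0) (p0 ord0) _ e20.
  have d20 : 0 < d / 2 by rewrite divr_gt0.
  exists ([set zp : 'rV[R]_N * 'rV[R]_N |
             vnorm (vsub (zp.1 ord0 : V) (z0 ord0)) < d / 2 /\
             vnorm (vsub (zp.2 ord0 : V) (p0 ord0)) < d]%classic,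
          [set a : R | a < d / 2]%classic).
    split => /=.
      exists ([set v : 'rV[R]_N |
                 vnorm (vsub (v ord0 : V) (z0 ord0)) < d / 2]%classic,
              [set v : 'rV[R]_N |
                 vnorm (vsub (v ord0 : V) (p0 ord0)) < d]%classic).
        by split; exact: near_vnorm.
      by move=> [v w] [].
    apply/nbhs_ballP; exists (d / 2) => // a; rewrite /ball/= sub0r normrN.
    exact: le_lt_trans (ler_norm a).
  move=> [[z p] a] [/= [zd pd] ad] x xz.
  have h1 : `|H i x (p ord0) - H i (z0 ord0) (p0 ord0)| < e / 2.
    apply: hd => //; have := vnorm_sub_tri x (z ord0) (z0 ord0); lra.
  have h2 : `|H i (z ord0) (p ord0) - H i (z0 ord0) (p0 ord0)| < e / 2.
    by apply: hd => //; lra.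
  by move: h1 h2; rewrite !ltr_norml; lra.
(* The covering gives the property for every parameter in the ball of radius [d] around [0]; [d / 2]
   is a positive one. *)
exists (d / 2); split; first by rewrite divr_gt0.
move=> x z p pK xz; have [k zk] := unit_cube z.
have hB : (@box R N 0 1 `*` @box R N (- K) K)%classic
    (\row_j vadd z (vint R k) j, \row_j p j).
  split => j; rewrite mxE//= -ler_norml.
  exact: le_trans (vnorm_coord p j) pK.
have d2 : ball_ Num.norm 0 d (d / 2).
  by rewrite /ball_/= sub0r normrN gtr0_norm ?divr_gt0//; lra.
have := hd _ d2 _ hB (vadd x (vint R k)); rewrite /Q/= !row_vecK !pH; apply.
rewrite (_ : vsub _ _ = vsub x z)//.
by apply/funext => j; rewrite /vsub /vadd; ring.
Qed.

(** By coercivity, [H <= c + C] confines the momentum. [K] is chosen before [lam] and [u], which is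
    what makes the discounted family equi-Lipschitz. *)
Lemma subsolution_gradient_bound H (c C : R) : ham_hyp H ->
  exists2 K : R, 0 < K & forall B lam u, visc_sub B H lam c u ->
    (forall i x, - coup B lam u i x <= C) ->
    forall i x p, superdiff (u i) x p -> vnorm p < K.
Proof.
move=> [_ [_ [_ [al [be [cal [_ hal]]]]]]].
have [r hr] := cal (c + C + 1).
exists (`|r| + 1); first by rewrite ltr_wpDl.
move=> B lam u [_ su] uC i x p /su; have := uC i x.
have /andP[+ _] := hal i x p; rewrite ltNge; move=> h1 h2 h3.
apply/negP => rp; have := hr (vnorm p); have := ler_norm r; lra.
Qed.

Lemma sys_bounded u : sys_on_M u ->
  exists2 C : R, 0 <= C & forall i x, `|u i x| <= C.
Proof.
move=> uM.
have /choice[C hC] : forall i, exists C : R, 0 <= C /\ forall x, `|u i x| <= C.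
  move=> i; have [cu pu] := uM i.
  by have [C] := periodic_bounded cu pu; exists C.
have C0 i : 0 <= C i by have [] := hC i.
exists (\sum_i C i); first by apply: sumr_ge0.
move=> i x; have [_ /(_ x)/le_trans] := hC i; apply.
by rewrite (bigD1 i)//= lerDl sumr_ge0.
Qed.

Lemma coup_bound B lam u (C : R) i x : (forall i x, `|u i x| <= C) ->
  `|coup B lam u i x| <= (\sum_i \sum_j `|B i j| + `|lam|) * C.
Proof.
move=> uC; have C0 : 0 <= C by apply: le_trans (uC i x).
rewrite /coup mulrDl (le_trans (ler_normD _ _))// lerD//; last first.
  by rewrite normrM ler_wpM2l.
apply: (@le_trans _ _ (\sum_j `|B i j| * C)).
  apply: le_trans (ler_norm_sum _ _ _) _; apply: ler_sum => j _.
  by rewrite normrM ler_wpM2l.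
rewrite -mulr_suml ler_wpM2r// [leRHS](bigD1 i)//= lerDl.
by apply: sumr_ge0 => k _; apply: sumr_ge0.
Qed.

(** As rows sum to zero, [w j] may be replaced by [w j - w i]; each off-diagonal term is then a
    product of two nonpositive numbers. This is the maximum principle for the coupling. *)
Lemma coupling_max_ge0 B (w : 'I_m -> R) i : coupling B ->
  (forall j, w j <= w i) -> 0 <= \sum_j B i j * w j.
Proof.
move=> [Bneg [Bsum _]] wi.
have -> : \sum_j B i j * w j = \sum_j B i j * (w j - w i).
  under [RHS]eq_bigr do rewrite mulrBr.
  by rewrite sumrB -mulr_suml Bsum mul0r subr0.
apply: sumr_ge0 => j _; have [<-|ij] := eqVneq i j.
  by rewrite subrr mulr0.
by rewrite mulr_le0 ?Bneg// subr_le0.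
Qed.

(** Tripling of variables: [h] is taken at [z], [f] and [g] at their own points [z + a] and [z + b].
    Giving each penalty the weight of its function makes the gradients combine exactly. *)
Definition penalized (f g h : sys R N m) (t A : R) i z a b : R :=
  (1 - t) * (f i (vadd z a) - A * vnorm a ^+ 2) +
    t * (g i (vadd z b) - A * vnorm b ^+ 2) - h i z.

Lemma penalized_max (f g h : sys R N m) (t A : R) : (0 < m)%N ->
  sys_on_M f -> sys_on_M g -> sys_on_M h -> 0 < t < 1 -> 0 < A ->
  exists i z a b, forall j z' a' b',
    penalized f g h t A j z' a' b' <= penalized f g h t A i z a b.
Proof.
move=> m0 fM gM hM t01 A0.
have /choice[w hw] : forall i, exists w : V * V * V, forall z' a' b',
    penalized f g h t A i z' a' b' <= penalized f g h t A i w.1.1 w.1.2 w.2.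
  move=> i; have [[cf pf] [cg pg] [ch ph]] := And3 (fM i) (gM i) (hM i).
  have [z [a [b zab]]] := doubling_max cf pf cg pg ch ph t01 A0.
  by exists (z, a, b).
pose val i := penalized f g h t A i (w i).1.1 (w i).1.2 (w i).2.
have [i _ hi] := @arg_maxP _ _ _ (Ordinal m0) predT val isT.
exists i, (w i).1.1, (w i).1.2, (w i).2 => j z' a' b'.
exact: le_trans (hw j z' a' b') (hi j isT).
Qed.

(** Vary one of the three points and hold the other two fixed. The weight [1 - (1 - t)] is left
    unsimplified to match the convexity hypothesis on [H] taken at [1 - t]. *)
Lemma penalized_gradients (f g h : sys R N m) (t A : R) i z a b :
  0 < t < 1 ->
  (forall j z' a' b',
    penalized f g h t A j z' a' b' <= penalized f g h t A i z a b) ->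
  [/\ superdiff (f i) (vadd z a) (vscale (2 * A) a),
      superdiff (g i) (vadd z b) (vscale (2 * A) b) &
      subdiff (h i) z (vadd (vscale (1 - t) (vscale (2 * A) a))
                            (vscale (1 - (1 - t)) (vscale (2 * A) b)))].
Proof.
move=> /andP[t0 t1] hmax; split.
- apply: (@superdiff_quad _ _ _ _ _ A 1) => // w _; set d := vsub w _.
  have ew : w = vadd z (vadd a d).
    by apply/funext => k; rewrite /d /vadd /vsub; ring.
  have := hmax i z (vadd a d) b; rewrite /penalized -ew vnorm_sqrD vdotZl.
  by move=> ?; rewrite -subr_ge0 -(@pmulr_rge0 _ (1 - t)) ?subr_gt0//; lra.
- apply: (@superdiff_quad _ _ _ _ _ A 1) => // w _; set d := vsub w _.
  have ew : w = vadd z (vadd b d).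
    by apply/funext => k; rewrite /d /vadd /vsub; ring.
  have := hmax i z a (vadd b d); rewrite /penalized -ew vnorm_sqrD vdotZl.
  by move=> ?; rewrite -subr_ge0 -(@pmulr_rge0 _ t)//; lra.
- apply/superdiffN; apply: (@superdiff_quad _ _ _ _ _ A 1) => // w _.
  set d := vsub w z.
  (* Moving the base point from [z] to [w] while the points of [f] and [g] stay in place changes
     both offsets by [- d]. *)
  have ea : vadd z a = vadd w (vsub a d).
    by apply/funext => k; rewrite /d /vadd /vsub; ring.
  have eb : vadd z b = vadd w (vsub b d).
    by apply/funext => k; rewrite /d /vadd /vsub; ring.
  have := hmax i w (vsub a d) (vsub b d).
  rewrite /penalized -ea -eb !vnorm_sqrB !vdotE; lra.
Qed.

(** A cone of slope [K] touching [f] from above away from its vertex would give a supergradient of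
    norm exactly [K], against the strict bound. So the contact is at the vertex, for every [x]. *)
Lemma gradient_bound_lipschitz (f : V -> R) (K : R) :
  vcontinuous f -> periodic f -> 0 < K ->
  (forall x p, superdiff f x p -> vnorm p < K) ->
  forall x y, f y - f x <= K * vnorm (vsub y x).
Proof.
move=> cf pf K0 hK x y.
have [a ha] := cone_max x cf pf K0.
have a0 : vnorm a = 0.
  apply/eqP; rewrite eq_le vnorm_ge0 andbT leNgt; apply/negP => a0.
  have : superdiff f (vadd x a) (vscale (K / vnorm a) a).
    apply: (@superdiff_quad _ _ _ _ _ (K / (2 * vnorm a)) 1) => // w _.
    set h := vsub w (vadd x a).
    have ew : w = vadd x (vadd a h).
      by apply/funext => k; rewrite /h /vadd /vsub; ring.
    have := ha (vadd a h); rewrite -ew vdotZl.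
    (* AM-GM: [2 |a + h| |a| <= |a + h|^2 + |a|^2] *)
    have am : vnorm (vadd a h) - vnorm a <=
        vdot a h / vnorm a + vnorm h ^+ 2 / (2 * vnorm a).
      rewrite -(@ler_pM2r _ (2 * vnorm a)) ?mulr_gt0// mulrBl [leRHS]mulrDl.
      rewrite divfK ?mulf_neq0 ?gt_eqF//.
      have -> : vdot a h / vnorm a * (2 * vnorm a) = 2 * vdot a h.
        by field; rewrite gt_eqF.
      have := vnorm_sqrD a h.
      have := sqr_ge0 (vnorm (vadd a h) - vnorm a); nra.
    have -> : K / vnorm a * vdot a h + K / (2 * vnorm a) * vnorm h ^+ 2 =
       K * (vdot a h / vnorm a + vnorm h ^+ 2 / (2 * vnorm a)).
      by field; rewrite gt_eqF.
    nra.
  move=> /hK; rewrite vnormZ ger0_norm ?divfK ?gt_eqF ?ltxx//.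
  by rewrite divr_ge0 ?vnorm_ge0// ltW.
have := ha (vsub y x); rewrite vadd_sub a0 mulr0 subr0.
have -> : vadd x a = x.
  by apply/funext => k; rewrite /vadd (vnorm_eq0 _ a0) addr0.
lra.
Qed.

Lemma subsolution_lipschitz H (c C : R) : ham_hyp H ->
  exists2 K : R, 0 < K & forall B lam u, visc_sub B H lam c u ->
    (forall i x, - coup B lam u i x <= C) ->
    forall i x y, `|u i y - u i x| <= K * vnorm (vsub y x).
Proof.
move=> hH; have [K K0 hK] := subsolution_gradient_bound c C hH.
exists K => // B lam u su uC i x y.
have [cu pu] := su.1 i.
have lip := gradient_bound_lipschitz cu pu K0 (hK _ _ _ su uC i).
have := lip x y; have := lip y x; rewrite (vnormBC x) ler_norml; lra.
Qed.

Lemma subsolution_bounds H B (c lam : R) u :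
  ham_hyp H -> visc_sub B H lam c u ->
  exists K : R, [/\ 0 < K,
    forall i x p, superdiff (u i) x p -> vnorm p < K &
    forall i x y, `|u i y - u i x| <= K * vnorm (vsub y x)].
Proof.
move=> hH su; have [C C0 uC] := sys_bounded su.1.
pose D := (\sum_i \sum_j `|B i j| + `|lam|) * C.
have uD i x : - coup B lam u i x <= D.
  have := coup_bound B lam i x uC; rewrite ler_norml => /andP[h _].
  by rewrite lerNl.
have [K1 K10 h1] := subsolution_gradient_bound c D hH.
have [K2 K20 h2] := subsolution_lipschitz c D hH.
exists (K1 + K2); split; first exact: addr_gt0.
  by move=> i x p /(h1 _ _ _ su uD); lra.
move=> i x y; apply: le_trans (h2 _ _ _ su uD i x y) _.
by rewrite ler_wpM2r ?vnorm_ge0// lerDr ltW.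
Qed.

(** The common engine of the bounds and of the interpolation: at a near-maximum of
    [(1 - t) f + t g - h] over components and points, convexity cancels the Hamiltonians and
    maximality of the component disposes of the coupling, so only the discount terms remain. *)
Lemma comparison_three H B f g h (la lb l c t e : R) : (0 < m)%N ->
  ham_hyp H -> coupling B -> 0 < t < 1 -> 0 < e ->
  visc_sub B H la c f -> visc_sub B H lb c g -> visc_super B H l c h ->
  exists i z,
    (1 - t) * (la * f i z) + t * (lb * g i z) - l * h i z <= e /\
    forall j x, (1 - t) * f j x + t * g j x - h j x <=
                (1 - t) * f i z + t * g i z - h i z + e.
Proof.
move=> m0 hH hB t01 e0 sf sg sh; have /andP[t0 t1] := t01.
have [Kf [Kf0 gradf lipf]] := subsolution_bounds hH sf.
have [Kg [Kg0 gradg lipg]] := subsolution_bounds hH sg.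
pose K := Kf + Kg; have K0 : 0 < K by exact: addr_gt0.
have e20 : 0 < e / 2 by rewrite divr_gt0.
have [d d0 hd] := ham_uniform K hH e20.
pose L := 1 + `|la| + `|lb|.
have L0 : 0 < L by rewrite ltr_wpDr// ltr_wpDr.
(* [s] is the size wanted for the offsets: below [d] for the continuity of [H], and small enough for
   the Lipschitz errors, weighted by [L], to fit in [e / 2]. With [2 * A = K / s], the gradient
   bound [K] forces offsets below [s]. *)
pose s := Num.min d (e / 2 / (L * K)).
have s0 : 0 < s by rewrite lt_min d0 divr_gt0// mulr_gt0.
have sd : s <= d by rewrite ge_min lexx.
have sK : L * (K * s) <= e / 2.
  by rewrite mulrA -ler_pdivlMl ?mulr_gt0// mulrC ge_min lexx orbT.
pose A := K / (2 * s).
have A0 : 0 < A by rewrite divr_gt0// mulr_gt0.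
have [i [z [a [b hmax]]]] := penalized_max m0 sf.1 sg.1 sh.1 t01 A0.
have [pf pg ph] := penalized_gradients t01 hmax.
have small (v : V) : vnorm (vscale (2 * A) v) < K -> vnorm v < s.
  have A20 : 0 < 2 * A by rewrite pmulr_rgt0.
  rewrite vnormZ gtr0_norm//.
  have -> : 2 * A = K / s by rewrite /A; field; rewrite gt_eqF.
  by rewrite mulrAC ltr_pdivrMr// ltr_pM2l.
have gf := gradf _ _ _ pf; have gg := gradg _ _ _ pg.
have nf : vnorm (vscale (2 * A) a) < K by rewrite /K; lra.
have ng : vnorm (vscale (2 * A) b) < K by rewrite /K; lra.
have na := small _ nf; have nb := small _ ng.
set p := vscale _ a in pf ph nf gf; set q := vscale _ b in pg ph ng gg.
set P := vadd z a in pf; set Q := vadd z b in pg.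
have fP : `|f i P - f i z| <= K * s.
  apply: le_trans (lipf i z P) _; rewrite vsub_add.
  apply: ler_pM (ltW Kf0) (vnorm_ge0 _) _ (ltW na); rewrite /K; lra.
have gQ : `|g i Q - g i z| <= K * s.
  apply: le_trans (lipg i z Q) _; rewrite vsub_add.
  apply: ler_pM (ltW Kg0) (vnorm_ge0 _) _ (ltW nb); rewrite /K; lra.
have HP : `|H i P p - H i z p| < e / 2.
  by apply: hd; [exact: ltW|rewrite vsub_add (lt_le_trans na)].
have HQ : `|H i Q q - H i z q| < e / 2.
  by apply: hd; [exact: ltW|rewrite vsub_add (lt_le_trans nb)].
have Ks : 0 <= K * s by rewrite mulr_ge0// ltW.
exists i, z; split; last first.
  move=> j x; have := hmax j x (fun=> 0) (fun=> 0).
  rewrite /penalized !vadd0 !vnorm0 expr0n/= -/P -/Q.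
  have : 0 <= A * vnorm a ^+ 2 by rewrite mulr_ge0 ?sqr_ge0// ltW.
  have : 0 <= A * vnorm b ^+ 2 by rewrite mulr_ge0 ?sqr_ge0// ltW.
  have : 1 * (K * s) <= L * (K * s).
    by rewrite ler_wpM2r// /L -addrA lerDl addr_ge0.
  by move: fP gQ; rewrite !ler_norml; nra.
have Sf := sf.2 _ _ _ pf; have Sg := sg.2 _ _ _ pg; have Sh := sh.2 _ _ _ ph.
have [_ [_ [cvx _]]] := hH.
have t1' : 0 <= 1 - t <= 1 by lra.
have {cvx} := cvx i z p q _ t1'.
(* At fixed [z], [a], [b] the penalty is the same for all components, so [i] maximizes the
   combination itself. *)
have : 0 <= \sum_j B i j * ((1 - t) * f j P + t * g j Q - h j z).
  apply: (coupling_max_ge0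
    (w := fun j => (1 - t) * f j P + t * g j Q - h j z)) => // j.
  by have := hmax j z a b; rewrite /penalized -/P -/Q; lra.
have -> : \sum_j B i j * ((1 - t) * f j P + t * g j Q - h j z) =
   (1 - t) * (\sum_j B i j * f j P) + t * (\sum_j B i j * g j Q) -
   \sum_j B i j * h j z.
  rewrite !mulr_sumr -big_split -sumrB; apply: eq_bigr => j _ /=; ring.
move: Sf Sg Sh; rewrite /coup.
set r := vadd _ _; set SF := \sum_j _ * f j P; set SG := \sum_j _ * g j Q.
set SH := \sum_j _ * h j z => Sf Sg Sh Sge0 cvx.
(* The discount terms are carried from the points [P] and [Q] back to [z]. *)
have lf : `|la * (f i P - f i z)| <= `|la| * (K * s).
  by rewrite normrM ler_wpM2l.
have lg : `|lb * (g i Q - g i z)| <= `|lb| * (K * s).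
  by rewrite normrM ler_wpM2l.
move: sK HP HQ lf lg; rewrite /L !ler_norml !ltr_norml.
have := normr_ge0 la; have := normr_ge0 lb.
nra.
Qed.

End Subsolutions.

(** * Uniform Cauchy property of the discounted solutions *)

Section VanishingDiscount.
Context {R : realType} {N m : nat}.
Local Notation V := (vec R N).
Implicit Types (x y z p q : V) (B : 'M[R]_m) (H : Ham R N m) (u v : sys R N m).

(** Compare [u] with the critical solution [v] from both sides, with [f = g]. Since [v] has discount
    [0], the contact inequality bounds [lam * u] alone; an error at most [lam] then gives [u >= -1]
    or [u <= 1] at the contact point. *)
Lemma discounted_bound H B (c : R) v : (0 < m)%N -> ham_hyp H -> coupling B ->
  visc_sol B H 0 c v ->
  exists2 C : R, 0 <= C & forall lam u, 0 < lam -> visc_sol B H lam c u ->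
    forall i x, `|u i x| <= C.
Proof.
move=> m0 hH hB [sv Sv]; have [C C0 vC] := sys_bounded sv.1.
exists (2 * C + 2); first by rewrite addr_ge0 ?mulr_ge0.
move=> lam u lam0 [su Su] j x.
have e0 : 0 < Num.min lam 1 by rewrite lt_min lam0 ltr01.
have e1 : Num.min lam 1 <= lam by rewrite ge_min lexx.
have e2 : Num.min lam 1 <= 1 by rewrite ge_min lexx orbT.
have half : 0 < (2^-1 : R) < 1 by lra.
have [i [z [zi zj]]] := comparison_three m0 hH hB half e0 sv sv Su.
have [k [w [wk wj]]] := comparison_three m0 hH hB half e0 su su Sv.
have ui : -1 <= u i z by rewrite -(ler_pM2l lam0); lra.
have uk : u k w <= 1 by rewrite -(ler_pM2l lam0); lra.
have := zj j x; have := wj j x.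
have := vC i z; have := vC k w; have := vC j x.
by rewrite !ler_norml; lra.
Qed.

(** Total boundedness in the style of Arzela-Ascoli: the key records the values on a grid of the
    unit cube, rounded to multiples of [e / 3]. Equal keys cost one third for the rounding and one
    third for each function's variation up to the grid. *)
Lemma finite_classes (C K e : R) : 0 < e -> 0 <= C -> 0 <= K ->
  exists (T : finType) (key : sys R N m -> T), forall u v,
    (forall i, periodic (u i)) -> (forall i, periodic (v i)) ->
    (forall i x, `|u i x| <= C) -> (forall i x, `|v i x| <= C) ->
    (forall i x y, `|u i y - u i x| <= K * vnorm (vsub y x)) ->
    (forall i x y, `|v i y - v i x| <= K * vnorm (vsub y x)) ->
    key u = key v -> forall i x, `|u i x - v i x| <= e.
Proof.
move=> e0 C0 K0; pose s := e / 3; have s0 : 0 < s by rewrite divr_gt0.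
pose n := (Num.truncn (K * N%:R / s)).+1.
have n0 : 0 < n%:R :> R by rewrite ltr0n.
have Kn : K * (N%:R * n%:R^-1) <= s.
  rewrite mulrA ler_pdivrMr// -ler_pdivrMl// [leLHS]mulrC.
  by rewrite ltW// truncnS_gt.
pose M := Num.truncn (2 * C / s).
pose pt (g : {ffun 'I_N -> 'I_n.+1}) : V := fun k => (g k)%:R / n%:R.
pose lev u i (g : {ffun 'I_N -> 'I_n.+1}) := Num.truncn ((u i (pt g) + C) / s).
exists {ffun 'I_m * {ffun 'I_N -> 'I_n.+1} -> 'I_M.+1}.
exists (fun u => [ffun ig => inord (lev u ig.1 ig.2)]) => u v pu pv uC vC uK vK.
move=> /ffunP uv i x.
have levM w j g : (forall i x, `|w i x| <= C) -> (lev w j g < M.+1)%N.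
  move=> wC; rewrite ltnS le_truncn// ler_pM2r ?invr_gt0//.
  by have := wC j (pt g); rewrite ler_norml; lra.
have levP w j g : (forall i x, `|w i x| <= C) ->
    (lev w j g)%:R * s <= w j (pt g) + C < (lev w j g)%:R * s + s.
  move=> wC; have : 0 <= (w j (pt g) + C) / s.
    rewrite divr_ge0 ?(ltW s0)//.
    by have := wC j (pt g); rewrite ler_norml; lra.
  move/truncn_itv; rewrite -/(lev w j g) ler_pdivlMr// ltr_pdivrMr//.
  by rewrite -natr1 mulrDl mul1r.
have [k kx] := unit_cube x.
rewrite -(pu i x k) -(pv i x k); set y := vadd x _ in kx *.
(* A coordinate equal to [1] gives the index [n], so the grid has [n.+1] nodes per axis. *)
pose g : {ffun 'I_N -> 'I_n.+1} := [ffun j => inord (Num.truncn (n%:R * y j))].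
have yg : vnorm (vsub y (pt g)) <= N%:R * n%:R^-1.
  apply: vnorm_le_coord; first by rewrite invr_ge0 ltW.
  move=> j; have /andP[y0 y1] := kx j; have ny : 0 <= n%:R * y j.
    by rewrite mulr_ge0// ltW.
  rewrite /vsub /pt ffunE inordK; last first.
    have /andP[h _] := truncn_itv ny; rewrite ltnS -(ler_nat R).
    by apply: le_trans h _; rewrite ler_piMr// ltW.
  have := truncn_itv ny; set l := Num.truncn _; rewrite -natr1 => /andP[h1 h2].
  have -> : y j - l%:R / n%:R = (n%:R * y j - l%:R) / n%:R.
    by rewrite mulrBl [n%:R * y j]mulrC mulfK// gt_eqF.
  rewrite normrM (gtr0_norm (x := n%:R^-1)) ?invr_gt0//.
  by rewrite ler_piMl ?invr_ge0 ?(ltW n0)// ler_norml; lra.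
have uvg : lev u i g = lev v i g.
  have := congr1 (@nat_of_ord _) (uv (i, g)).
  by rewrite !ffunE/= !inordK ?levM.
have := levP _ i g uC; have := levP _ i g vC; rewrite uvg.
have hu := uK i (pt g) y; have hv := vK i (pt g) y.
have := le_trans hu (ler_wpM2l K0 yg); have := le_trans hv (ler_wpM2l K0 yg).
move: Kn; rewrite /s !ler_norml; lra.
Qed.

(** A key that does not recur near [0] is absent below some threshold; take the least threshold over
    the finitely many keys. *)
Lemma recurrent_classes (T : finType) (key : R -> T) :
  exists2 d : R, 0 < d & forall mu, 0 < mu < d -> forall d' : R, 0 < d' ->
    exists nu, 0 < nu < d' /\ key nu = key mu.
Proof.
have /choice[D hD] : forall k, exists d : R, 0 < d /\
    ((exists2 nu, 0 < nu < d & key nu = k) -> forall d' : R, 0 < d' ->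
     exists nu, 0 < nu < d' /\ key nu = k).
  move=> k; have [h|/existsNP[d /not_implyP[d0 h]]] := pselect
    (forall d' : R, 0 < d' -> exists nu, 0 < nu < d' /\ key nu = k).
    by exists 1.
  by exists d; split => // -[nu nud nuk]; exfalso; apply: h; exists nu.
have [k|d d0 dD] := @fin_lower_bound _ _ D; first by have [] := hD k.
exists d => // mu /andP[mu0 mud] d' d'0; have [_] := hD (key mu); apply => //.
by exists mu => //; rewrite mu0 (lt_le_trans mud).
Qed.

(* With [lam = (1 - t) nu + t mu], the function [(1 - t) un + t um] misses being
   a [lam]-subsolution only by a multiple, at most [lam], of [un - um]. *)
Lemma interpolation H B (c nu lam mu e : R) (un ul um : sys R N m) :
  (0 < m)%N -> ham_hyp H -> coupling B -> 0 < e ->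
  0 < nu -> nu < lam -> lam < mu ->
  visc_sub B H nu c un -> visc_super B H lam c ul -> visc_sub B H mu c um ->
  (forall i x, `|un i x - um i x| <= e) ->
  forall i x, um i x - 3 * e <= ul i x.
Proof.
move=> m0 hH hB e0 nu0 nl lm sn Sl sm close j x.
pose t := (lam - nu) / (mu - nu).
have munu : 0 < mu - nu by lra.
have t0 : 0 < t by rewrite divr_gt0// subr_gt0.
have t1 : t < 1 by rewrite ltr_pdivrMr// mul1r; lra.
have t01 : 0 < t < 1 by rewrite t0.
have tE : t * (mu - nu) = lam - nu by rewrite divfK ?gt_eqF.
have lam0 : 0 < lam by lra.
(* The first bound leaves [e / 2] after division by [lam], the second is the comparison error at
   other points. With [e] from the closeness at [z] and at most [e] for replacing [un] by [um], the
   total is [3 * e]. *)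
pose eta := Num.min (lam * (e / 2)) (e / 2).
have eta0 : 0 < eta by rewrite lt_min mulr_gt0//= divr_gt0.
have eta1 : eta <= lam * (e / 2) by rewrite ge_min lexx.
have eta2 : eta <= e / 2 by rewrite ge_min lexx orbT.
have [i [z [zi zj]]] := comparison_three m0 hH hB t01 eta0 sn sm Sl.
have wi : (1 - t) * un i z + t * um i z - ul i z <= e + e / 2.
  rewrite -(ler_pM2l lam0).
  (* By the choice of [t], also [s = (1 - t) * (lam - nu)]; hence [s <= lam], and the excess
     discount terms combine into [s * (un - um)]. *)
  pose s := t * (mu - lam).
  have s0 : 0 <= s by rewrite mulr_ge0 ?(ltW t0)// subr_ge0 ltW.
  have sl : s <= lam.
    have -> : s = (1 - t) * (lam - nu) by rewrite /s; lra.
    by nra.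
  have cz : un i z - um i z <= e.
    by have := close i z; rewrite ler_norml; lra.
  have : s * (un i z - um i z) <= lam * e.
    apply: le_trans (ler_wpM2l s0 cz) _; by rewrite ler_wpM2r// ltW.
  have -> : s * (un i z - um i z) =
     (1 - t) * (lam - nu) * un i z - t * (mu - lam) * um i z.
    have -> : (1 - t) * (lam - nu) = s by rewrite /s; lra.
    by rewrite /s; ring.
  lra.
have := zj j x; have := close j x; rewrite ler_norml => /andP[h1 h2].
have : (1 - t) * (um j x - e) <= (1 - t) * un j x.
  by rewrite ler_pM2l; lra.
have := mulr_gt0 t0 e0; lra.
Qed.

Lemma discounted_cauchy H B (c e : R) (u : R -> sys R N m) :
  (0 < m)%N -> ham_hyp H -> coupling B -> is_critical_value B H c ->
  (forall lam : R, 0 < lam -> visc_sol B H lam c (u lam)) -> 0 < e ->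
  exists2 d : R, 0 < d & forall lam mu, 0 < lam < d -> 0 < mu < d ->
    forall i x, `|u lam i x - u mu i x| <= 4 * e.
Proof.
move=> m0 hH hB [v sv] hu e0.
have [C C0 uC] := discounted_bound m0 hH hB sv.
pose D := (\sum_i \sum_j `|B i j| + 1) * C.
have coupD lam i x : 0 < lam -> lam < 1 -> - coup B lam (u lam) i x <= D.
  move=> l0 l1; have := coup_bound B lam i x (uC _ _ l0 (hu _ l0)).
  rewrite ler_norml => /andP[h _]; rewrite lerNl; apply: le_trans h.
  by rewrite lerN2 ler_wpM2r// lerD2l gtr0_norm// ltW.
have [K K0 hK] := subsolution_lipschitz c D hH.
have [T [key hkey]] := finite_classes e0 C0 (ltW K0).
have [d d0 hd] := recurrent_classes (fun lam => key (u lam)).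
(* Discounts below [1] make the bound [D] on the coupling, hence the Lipschitz constant, uniform. *)
pose d1 := Num.min d 1.
have classP lam mu : 0 < lam < 1 -> 0 < mu < 1 ->
    key (u lam) = key (u mu) -> forall i x, `|u lam i x - u mu i x| <= e.
  move=> /andP[l0 l1] /andP[n0 n1]; apply: hkey.
  - by move=> i; have [[sM _] _] := hu _ l0; have [] := sM i.
  - by move=> i; have [[sM _] _] := hu _ n0; have [] := sM i.
  - exact: uC (hu _ l0).
  - exact: uC (hu _ n0).
  - by apply: hK (hu _ l0).1 _ => i x; exact: coupD.
  - by apply: hK (hu _ n0).1 _ => i x; exact: coupD.
have lower lam mu : 0 < lam -> lam < mu -> mu < d1 ->
    forall i x, u mu i x - 3 * e <= u lam i x.
  move=> l0 lm; rewrite lt_min => /andP[md m1]; have mu0 := lt_trans l0 lm.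
  have [|nu [/andP[n0 nl] nm]] := hd mu _ lam l0; first by rewrite mu0.
  apply: (interpolation m0 hH hB e0 n0 nl lm
            (hu _ n0).1 (hu _ l0).2 (hu _ mu0).1).
  by apply: classP nm; rewrite ?n0 ?mu0//=; lra.
(* For the upper bound, pick [nu < lam] in the class of [mu]: then
   [u lam - 3 * e <= u nu <= u mu + e]. *)
have key_le lam mu : 0 < lam -> lam < mu -> mu < d1 ->
    forall i x, `|u lam i x - u mu i x| <= 4 * e.
  move=> l0 lm md1 i x; have := md1; rewrite lt_min => /andP[md m1].
  have mu0 := lt_trans l0 lm.
  have [|nu [/andP[n0 nl] nm]] := hd mu _ lam l0; first by rewrite mu0.
  have ne : `|u nu i x - u mu i x| <= e.
    by apply: classP nm i x; rewrite ?n0 ?mu0//=; lra.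
  have := lower _ _ l0 lm md1 i x.
  have := lower _ _ n0 nl (lt_trans lm md1) i x.
  by move: ne; rewrite !ler_norml; lra.
exists d1; first by rewrite lt_min d0 ltr01.
move=> lam mu /andP[l0 ld] /andP[n0 nd] i x.
have [lm|ml|->] := ltgtP lam mu; first exact: key_le.
  by rewrite distrC; exact: key_le.
by rewrite subrr normr0 mulr_ge0// ltW.
Qed.

(* The limit is the lower limit of [F lam w] as [lam] decreases to [0]. *)
Lemma uniform_cauchy_limit X (F : R -> X -> R) :
  (forall e : R, 0 < e -> exists2 d : R, 0 < d & forall lam mu,
     0 < lam < d -> 0 < mu < d -> forall w, `|F lam w - F mu w| <= e) ->
  exists F0 : X -> R, forall e : R, 0 < e -> exists2 d : R, 0 < d &
    forall lam, 0 < lam < d -> forall w, `|F lam w - F0 w| <= e.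
Proof.
move=> cF; pose A w : set R :=
  [set a | exists2 d : R, 0 < d &
           forall lam, 0 < lam < d -> a <= F lam w]%classic.
exists (fun w => sup (A w)) => e /cF[d d0 hd]; exists d => // lam ld w.
have AF : A w (F lam w - e).
  by exists d => // mu md; have := hd _ _ ld md w; rewrite ler_norml; lra.
have ubA : ubound (A w) (F lam w + e).
  move=> a [d' d'0 ha]; pose mu := Num.min d d' / 2.
  have dd : 0 < Num.min d d' by rewrite lt_min d0.
  have dd1 : Num.min d d' <= d by rewrite ge_min lexx.
  have dd2 : Num.min d d' <= d' by rewrite ge_min lexx orbT.
  have md : 0 < mu < d by rewrite /mu; lra.
  have md' : 0 < mu < d' by rewrite /mu; lra.
  by have := ha _ md'; have := hd _ _ ld md w; rewrite ler_norml; lra.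
have h1 : F lam w - e <= sup (A w).
  by apply: ub_le_sup => //; exists (F lam w + e).
have h2 : sup (A w) <= F lam w + e by apply: ge_sup => //; exists (F lam w - e).
by rewrite ler_norml; lra.
Qed.

End VanishingDiscount.

(** * Stability of viscosity solutions under uniform limits *)

Section Stability.
Context {R : realType} {N m : nat}.
Local Notation V := (vec R N).
Implicit Types (x y z p q : V) (B : 'M[R]_m) (H : Ham R N m) (u v : sys R N m).

(** A quadratic penalty makes the contact at [x] strict, so a uniformly close [g] has a contact
    point nearby, with a nearby slope. *)
Lemma superdiff_approx (f : V -> R) x p (e : R) : superdiff f x p -> 0 < e ->
  exists2 eta : R, 0 < eta & forall g, vcontinuous g ->
    (forall y, `|g y - f y| <= eta) ->
    exists y q, [/\ superdiff g y q, vnorm (vsub y x) < e &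
                    vnorm (vsub q p) < e].
Proof.
move=> fp e0; pose s := e / 4; have s0 : 0 < s by rewrite divr_gt0.
have [d d0 hd] := fp s s0.
(* Subtracting [A |y - x|^2] with [A r = 2 s] keeps the maximum of the perturbed
   function inside the ball of radius [r]. *)
pose r := Num.min e (d / N.+1%:R).
have r0 : 0 < r by rewrite lt_min e0 divr_gt0.
have re : r <= e by rewrite ge_min lexx.
have rd (a : V) : box (- r) r (\row_k a k) -> vnorm a < d.
  move=> aB; apply: (@le_lt_trans _ _ (N%:R * r)).
    apply: vnorm_le_coord; first exact: ltW.
    by move=> k; have := aB k; rewrite mxE ler_norml.
  have : r <= d / N.+1%:R by rewrite ge_min lexx orbT.
  rewrite ler_pdivlMr ?ltr0Sn// -natr1; nra.
(* At distance [r] or more the penalized [f] is at least [r * s] below its value at [x], while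
   passing to [g] at two points costs at most [r * s / 2]. *)
exists (r * s / 4); first by rewrite divr_gt0// mulr_gt0.
move=> g cg gf; pose A := 2 * s / r.
have A0 : 0 < A by rewrite divr_gt0// mulr_gt0.
have Ar : A * r = 2 * s by rewrite /A divfK// gt_eqF.
pose G (v : 'rV[R]_N) := g (vadd x (v ord0)) - vdot p (v ord0)
                         - A * vnorm (v ord0 : V) ^+ 2.
have cG : continuous G.
  have c1 := vcontinuous_translate (x := x) cg.
  have c2 : continuous (fun v : 'rV[R]_N => A * vnorm (v ord0 : V) ^+ 2).
    move=> v; apply: cvgMl_tmp.
    exact: (cvgM (@vnorm_continuous R N v) (@vnorm_continuous R N v)).
  move=> v; apply: cvgB; last exact: c2.
  by apply: cvgB; [exact: c1|exact: vdot_continuous].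
have B0 : (@box R N (- r) r !=set0)%classic.
  by exists (\row_k ((fun=> 0) : V) k); exact: (box0 (ltW r0)).
have [c cB hc] := compact_EVT_max B0 (@box_compact R N (- r) r)
  (continuous_subspaceT cG (A := box (- r) r)).
pose a : V := c ord0.
have Gmax b : box (- r) r (\row_k b k) ->
    g (vadd x b) - vdot p b - A * vnorm b ^+ 2 <=
    g (vadd x a) - vdot p a - A * vnorm a ^+ 2.
  by move=> bB; have := hc _ (mem_set bB); rewrite /G row_vecK.
have ar : vnorm a < r.
  have ad : vnorm a < d.
    apply: rd; rewrite inE in cB; move=> k; rewrite mxE; exact: cB.
  have := hd (vadd x a); rewrite vsub_add => /(_ ad) h1.
  have := Gmax _ (@box0 R N r (ltW r0)); rewrite vadd0 vnorm0 expr0n/= mulr0.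
  have -> : vdot p (fun=> 0) = 0 by rewrite /vdot big1// => k _; rewrite mulr0.
  have := gf x; have := gf (vadd x a); rewrite !ler_norml => g1 g2 h2.
  rewrite ltNge; apply/negP => ra.
  have h3 : A * vnorm a ^+ 2 - s * vnorm a <= r * s / 2 by lra.
  have h4 : r * s <= vnorm a * (A * vnorm a - s).
    apply: ler_pM => //; [exact: ltW|exact: ltW|].
    have : A * r <= A * vnorm a by rewrite ler_pM2l.
    lra.
  have := mulr_gt0 r0 s0; lra.
exists (vadd x a), (vadd p (vscale (2 * A) a)); split; last 2 first.
- by rewrite vsub_add (lt_le_trans ar).
(* The slope moves by [2 * A * |a| < 2 * A * r = 4 * s = e]. *)
- have A20 : 0 < 2 * A by rewrite pmulr_rgt0.
  rewrite vsub_add vnormZ gtr0_norm//.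
  have : A * vnorm a < A * r by rewrite ltr_pM2l.
  by rewrite Ar /s; lra.
have ra0 : 0 < r - vnorm a by rewrite subr_gt0.
apply: (superdiff_quad ra0 (A := A)) => w; set h := vsub w _ => hw.
have ew : w = vadd x (vadd a h).
  by apply/funext => k; rewrite /h /vadd /vsub; ring.
have : box (- r) r (\row_k vadd a h k).
  move=> k; rewrite mxE -ler_norml.
  by have := vnorm_coord (vadd a h) k; have := vnormD a h; lra.
by move=> /Gmax; rewrite -ew vnorm_sqrD !vdotE; lra.
Qed.

Lemma residual_close H B u i x p (e : R) : ham_hyp H ->
  (forall j, vcontinuous (u j)) -> 0 < e ->
  exists2 d : R, 0 < d & forall (lam : R) v y q, 0 <= lam <= d ->
    (forall j z, `|v j z - u j z| <= d) ->
    vnorm (vsub y x) < d -> vnorm (vsub q p) < d ->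
    `|H i y q + coup B lam v i y - (H i x p + coup B 0 u i x)| <= e.
Proof.
move=> [cH _] cu e0.
pose S := \sum_j `|B i j|; have S0 : 0 <= S by exact: sumr_ge0.
(* [M] bounds [v i y], which is within [2 * k <= 2] of [u i x]; the zero-order terms then differ by
   at most [k * (2 * S + M)]. *)
pose M := `|u i x| + 2; have M0 : 0 < M by rewrite ltr_wpDl.
have SM : 0 < 2 * S + M by rewrite ltr_wpDl ?mulr_ge0.
pose k := Num.min 1 (e / 2 / (2 * S + M)).
have k0 : 0 < k by rewrite lt_min ltr01 !divr_gt0.
have k1 : k <= 1 by rewrite ge_min lexx.
have kS : k * (2 * S + M) <= e / 2.
  by rewrite -ler_pdivlMr// ge_min lexx orbT.
clearbody k; have e20 : 0 < e / 2 by rewrite divr_gt0.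
have [d1 d10 h1] := cH i x p _ e20.
have /choice[D hD] : forall j, exists d : R, 0 < d /\
    forall y, vnorm (vsub y x) < d -> `|u j y - u j x| < k.
  by move=> j; have [d d0 h] := cu j x k k0; exists d.
have [j|d2 d20 h2] := @fin_lower_bound R _ D; first by have [] := hD j.
exists (Num.min k (Num.min d1 d2)); first by rewrite !lt_min k0 d10.
move=> lam v y q; rewrite !le_min !lt_min => /andP[l0 /and3P[lk _ _]] vu.
move=> /and3P[_ y1 y2] /and3P[_ q1 _].
have vux j : `|v j y - u j x| <= 2 * k.
  have [_ /(_ y)] := hD j; have := vu j y; rewrite le_min => /andP[a1 _].
  move=> /(_ (lt_le_trans y2 (h2 j))) a2.
  by move: a1 a2; rewrite ltr_norml !ler_norml; lra.
have hH : `|H i y q - H i x p| < e / 2 by exact: h1.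
have hc : `|coup B lam v i y - coup B 0 u i x| <= S * (2 * k) + k * M.
  rewrite /coup mul0r addr0 addrAC -sumrB (le_trans (ler_normD _ _))// lerD//.
    rewrite (le_trans (ler_norm_sum _ _ _))// mulr_suml ler_sum// => j _.
    by rewrite -mulrBr normrM ler_wpM2l.
  rewrite normrM (ger0_norm l0) ler_pM//.
  by have := vux i; rewrite /M !ler_norml; have := ler_norm (u i x);
     have := ler_norm (- u i x); rewrite normrN; lra.
have : S * (2 * k) + k * M <= e / 2 by rewrite (le_trans _ kS)//; lra.
by move: hH hc; rewrite ltr_norml !ler_norml; lra.
Qed.

Lemma uniform_limit_on_M (u : R -> sys R N m) u0 (e0 : R) : 0 < e0 ->
  (forall lam, 0 < lam < e0 -> sys_on_M (u lam)) ->
  (forall e : R, 0 < e -> exists2 d : R, 0 < d &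
    forall lam, 0 < lam < d -> forall i x, `|u lam i x - u0 i x| <= e) ->
  sys_on_M u0.
Proof.
move=> e00 uM cvg.
have approx e : 0 < e -> exists2 v, sys_on_M v &
    forall i x, `|v i x - u0 i x| <= e.
  move=> /cvg[d d0 hd]; pose lam := Num.min d e0 / 2.
  have dd : 0 < Num.min d e0 by rewrite lt_min d0.
  have dd1 : Num.min d e0 <= d by rewrite ge_min lexx.
  have dd2 : Num.min d e0 <= e0 by rewrite ge_min lexx orbT.
  exists (u lam); first by apply: uM; rewrite /lam; lra.
  by apply: hd; rewrite /lam; lra.
move=> i; split.
  move=> x e e1; have e4 : 0 < e / 4 by rewrite divr_gt0.
  have [v vM vu] := approx _ e4; have [cv _] := vM i.
  have [d d0 hd] := cv x _ e4; exists d => // y /hd.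
  by have := vu i x; have := vu i y; rewrite !ltr_norml !ler_norml; lra.
move=> x z; apply/eqP; rewrite -subr_eq0 -normr_le0; apply/ler_addgt0Pr => e e1.
have e2 : 0 < e / 2 by rewrite divr_gt0.
have [v vM vu] := approx _ e2; have [_ pv] := vM i.
have := vu i x; have := vu i (vadd x (vint R z)); rewrite pv !ler_norml; lra.
Qed.

Lemma stability H B c (u : R -> sys R N m) u0 : ham_hyp H ->
  (forall lam, 0 < lam -> visc_sol B H lam c (u lam)) ->
  (forall e : R, 0 < e -> exists2 d : R, 0 < d &
    forall lam, 0 < lam < d -> forall i x, `|u lam i x - u0 i x| <= e) ->
  visc_sol B H 0 c u0.
Proof.
move=> hH hu cvg.
have u0M : sys_on_M u0.
  apply: (uniform_limit_on_M (ltr01 : 0 < 1 :> R) _ cvg) => lam /andP[l0 _].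
  by have [[]] := hu _ l0.
have small e : 0 < e -> exists lam, [/\ 0 < lam, lam <= e &
    forall i x, `|u lam i x - u0 i x| <= e].
  move=> e0; have [d d0 hd] := cvg _ e0.
  have dd : 0 < Num.min d e by rewrite lt_min d0.
  have dd1 : Num.min d e <= d by rewrite ge_min lexx.
  have dd2 : Num.min d e <= e by rewrite ge_min lexx orbT.
  exists (Num.min d e / 2); split; [lra|lra|].
  by apply: hd; lra.
have cu0 j : vcontinuous (u0 j) by have [] := u0M j.
split; split => // i x p.
- move=> sp; apply/ler_addgt0Pr => e e0.
  have [d d0 hd] := residual_close B i x p hH cu0 e0.
  have [eta eta0 heta] := superdiff_approx sp d0.
  have de : 0 < Num.min d eta by rewrite lt_min d0.
  have de1 : Num.min d eta <= d by rewrite ge_min lexx.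
  have de2 : Num.min d eta <= eta by rewrite ge_min lexx orbT.
  have [lam [l0 le uu]] := small _ de.
  have [su _] := hu _ l0; have [cu _] := su.1 i.
  have [|y [q [sq yx qp]]] := heta _ cu.
    by move=> y; exact: le_trans (uu i y) de2.
  have lam_d : 0 <= lam <= d by lra.
  have ud j z : `|u lam j z - u0 j z| <= d by exact: le_trans (uu j z) de1.
  have := hd _ _ _ _ lam_d ud yx qp.
  by have := su.2 _ _ _ sq; rewrite ler_norml; lra.
(* The supersolution half applies the same approximation to [- u0] and [- u lam], then changes the
   sign of the slope found. *)
- move=> /superdiffN sp; apply/ler_addgt0Pr => e e0.
  have [d d0 hd] := residual_close B i x p hH cu0 e0.
  have [eta eta0 heta] := superdiff_approx sp d0.
  have de : 0 < Num.min d eta by rewrite lt_min d0.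
  have de1 : Num.min d eta <= d by rewrite ge_min lexx.
  have de2 : Num.min d eta <= eta by rewrite ge_min lexx orbT.
  have [lam [l0 le uu]] := small _ de.
  have [_ Su] := hu _ l0; have [cu _] := Su.1 i.
  have [||y [q [sq yx qp]]] := heta (fun y => - u lam i y).
  + move=> y f f0; have [d' d'0 h] := cu y f f0; exists d' => // w /h.
    by rewrite -opprD normrN.
  + by move=> y; rewrite -opprD normrN; exact: le_trans (uu i y) de2.
  have qN : q = vscale (-1) (vscale (-1) q).
    by apply/funext => k; rewrite /vscale; ring.
  rewrite qN in sq; move/superdiffN in sq.
  have qp' : vnorm (vsub (vscale (-1) q) p) < d.
    rewrite (_ : vsub _ _ = vscale (-1) (vsub q (vscale (-1) p))).
      by rewrite vnormZ normrN1 mul1r.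
    by apply/funext => k; rewrite /vscale /vsub; ring.
  have lam_d : 0 <= lam <= d by lra.
  have ud j z : `|u lam j z - u0 j z| <= d by exact: le_trans (uu j z) de1.
  have := hd _ _ _ _ lam_d ud yx qp'.
  by have := Su.2 _ _ _ sq; rewrite ler_norml; lra.
Qed.

End Stability.

(** * Convergence to a critical solution *)

Theorem theorem1 (R : realType) (N m : nat) (hN : (0 < N)%N) (hm : (0 < m)%N)
  (H : Ham R N m) (B : 'M[R]_m) (c : R)
  (hH : ham_hyp H) (hB : coupling B) (hc : is_critical_value B H c)
  (u : R -> sys R N m)
  (hu : forall lam : R, 0 < lam -> visc_sol B H lam c (u lam)) :
  exists u0 : sys R N m,
    visc_sol B H 0 c u0 /\
    (forall e : R, 0 < e -> exists2 d : R, 0 < d &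
       forall lam : R, 0 < lam -> lam < d ->
         forall i x, `|u lam i x - u0 i x| < e).
Proof.
(* Pairing component and point as one index makes the limit uniform in both at once. *)
have [|u0 cvg] := @uniform_cauchy_limit _ ('I_m * vec R N)
    (fun lam ix => u lam ix.1 ix.2).
  move=> e e0; have e4 : 0 < e / 4 by rewrite divr_gt0.
  have [d d0 hd] := discounted_cauchy hm hH hB hc hu e4.
  exists d => // lam mu ld md [i x]; have := hd _ _ ld md i x => /=; lra.
exists (fun i x => u0 (i, x)); split.
  apply: (stability hH hu) => e /cvg[d d0 hd]; exists d => // lam ld i x.
  exact: (hd _ ld (i, x)).
move=> e e0; have e2 : 0 < e / 2 by rewrite divr_gt0.
have [d d0 hd] := cvg _ e2; exists d => // lam l0 ld i x.
have /hd/(_ (i, x)) : 0 < lam < d by rewrite l0.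
by move=> /= h; lra.
Qed.
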